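(* Let $G$ be the group of polynomial automorphisms of $\mathbb{C}^2$ with Jacobian determinant equal to $1$. Then $G$ has no non-trivial finite-dimensional representation; that is, for every integer $n\ge 1$, every group homomorphism $\rho: G\to \mathrm{GL}_n(\mathbb{C})$ is trivial.
   Context: A polynomial automorphism of $\mathbb{C}^2$ is a bijection $(x,y)\mapsto (F_1(x,y),F_2(x,y))$ with $F_1,F_2\in\mathbb{C}[x,y]$ whose inverse is also polynomial. The group law is composition. $G$ is considered as an abstract group; representations are abstract group homomorphisms into $\mathrm{GL}_n(\mathbb{C})$, with no continuity or algebraicity assumed. *)

(* Defs.v *)
From HB Require Import structures.
From mathcomp Require Import all_boot all_order all_algebra fingroup.
From mathcomp Require Import boolp reals complex mpoly.

Set Implicit Arguments.
Unset Strict Implicit.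
Unset Printing Implicit Defensive.

Import GRing.Theory Num.Theory.
Local Open Scope ring_scope.

(** The library's ['GL_n[R]] requires a finite base ring, whence this version
    over an arbitrary field. *)

Section GeneralLinear.
Context (K : fieldType) (n : nat).

Record GL := MkGL { GL_mx :> 'M[K]_n; GL_mxP : GL_mx \in unitmx }.

HB.instance Definition _ := [isSub for GL_mx].
HB.instance Definition _ := [Choice of GL by <:].

Definition GL_one : GL := MkGL (unitmx1 K n).

Lemma GL_mul_subproof (A B : GL) : (A *m B) \in unitmx.
Proof. by rewrite unitmx_mul !GL_mxP. Qed.
Definition GL_mul (A B : GL) : GL := MkGL (GL_mul_subproof A B).

Lemma GL_inv_subproof (A : GL) : invmx A \in unitmx.
Proof. by rewrite unitmx_inv GL_mxP. Qed.
Definition GL_inv (A : GL) : GL := MkGL (GL_inv_subproof A).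

Lemma GL_mulA : associative GL_mul.
Proof. by move=> A B C; apply: val_inj; rewrite /= mulmxA. Qed.
Lemma GL_1mul : left_id GL_one GL_mul.
Proof. by move=> A; apply: val_inj; rewrite /= mul1mx. Qed.
Lemma GL_mul1 : right_id GL_one GL_mul.
Proof. by move=> A; apply: val_inj; rewrite /= mulmx1. Qed.
Lemma GL_Vmul : left_inverse GL_one GL_inv GL_mul.
Proof. by move=> A; apply: val_inj; rewrite /= mulVmx ?GL_mxP. Qed.
Lemma GL_mulV : right_inverse GL_one GL_inv GL_mul.
Proof. by move=> A; apply: val_inj; rewrite /= mulmxV ?GL_mxP. Qed.

HB.instance Definition _ := isGroup.Build GL
  GL_mulA GL_1mul GL_mul1 GL_Vmul GL_mulV.

End GeneralLinear.

(** Points of [K^2] are row vectors, and a pair of bivariate polynomials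
    is a function ['I_2 -> {mpoly K[2]}]; the field [K] is of interest for
    [K := R[i]] with [R : realType], i.e. the complex numbers. *)

Section PolynomialMaps.
Context (K : numFieldType).
Implicit Types (F G : 'I_2 -> {mpoly K[2]}) (f g : 'rV[K]_2 -> 'rV[K]_2).

Definition poly_map F (z : 'rV[K]_2) : 'rV[K]_2 := \row_i (F i).@[z 0].

Definition jacobian_det F : {mpoly K[2]} := \det (\matrix_(i, j) (F i)^`M(j)).

Definition is_poly_map f : Prop := exists F, f = poly_map F.

Definition is_poly_aut f : Prop :=
  is_poly_map f /\ exists g, [/\ is_poly_map g, cancel f g & cancel g f].

(** The pair [F] representing [f] is unique since [K] is infinite, see
    [poly_map_inj]. *)
Definition has_jacobian1 f : Prop :=
  exists F, f = poly_map F /\ jacobian_det F = 1.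

Lemma meval_eq0 (p : {mpoly K[2]}) :
  (forall z : 'rV[K]_2, p.@[z 0] = 0) -> p = 0.
Proof.
move=> p0; set d := msize p.
pose e (m : 'X_{1..2}) := (m ord0 + d * m ord_max)%N.
pose q : {poly K} := \sum_(m <- msupp p) p@_m *: 'X^(e m).
have lt_d m i : m \in msupp p -> (m i < d)%N.
  move=> /msize_mdeg_lt; apply: leq_ltn_trans.
  by rewrite mdegE (bigD1 i) //= leq_addr.
have e_inj : {in msupp p &, injective e}.
  move=> m m' hm hm' eq_e; apply/mnmP.
  have eq0 : m ord0 = m' ord0.
    move: (congr1 (modn^~ d) eq_e).
    by rewrite /e !(mulnC d) !(addnC (_ ord0)) !modnMDl !modn_small ?lt_d.
  have eq1 : m ord_max = m' ord_max.
    move: eq_e; rewrite /e eq0 => /addnI/eqP; rewrite eqn_pmul2l => [/eqP//|].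
    exact: leq_ltn_trans (lt_d m ord0 hm).
  by case=> [[|[|//]] lti]; [move: eq0 | move: eq1];
    congr (m _ = m' _); apply: val_inj.
have q0 : q = 0.
  apply: (@roots_geq_poly_eq0 _ _ [seq k%:R | k <- iota 0 (size q)]).
  - apply/allP => x _; apply/rootP; rewrite /q horner_sum.
    have := p0 (\row_i (if i == ord0 then x else x ^+ d)).
    rewrite mevalE; apply: etrans; apply: eq_bigr => m _.
    rewrite hornerZ hornerXn big_ord_recl big_ord1 !mxE /= -exprM -exprD.
    by congr (_ * _ ^+ (_ + d * m _)); apply: val_inj.
  - rewrite map_inj_uniq ?iota_uniq //.
    by move=> i j /eqP; rewrite eqr_nat => /eqP.
  - by rewrite size_map size_iota.
apply/mpolyP => m; rewrite mcoeff0; apply/eqP; rewrite mcoeff_eq0.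
apply/negP => hm.
have := congr1 (fun r : {poly K} => r`_(e m)) q0.
rewrite coef0 coef_sum (bigD1_seq m) ?msupp_uniq //= coefZ coefXn eqxx mulr1.
rewrite big_seq_cond big1 => [|m' /andP[hm' nm]].
  by rewrite addr0; move/eqP; rewrite mcoeff_eq0 hm.
rewrite coefZ coefXn; case: eqP => [/e_inj eq_m|_]; last by rewrite mulr0.
by rewrite eq_m ?eqxx in nm.
Qed.

Lemma poly_map_inj F G : poly_map F = poly_map G -> F = G.
Proof.
move=> eqFG; apply/funext => i; apply/eqP; rewrite -subr_eq0; apply/eqP.
apply: meval_eq0 => z; rewrite mevalB.
by move: (congr1 (fun h : 'rV[K]_2 -> 'rV[K]_2 => h z 0 i) eqFG); rewrite !mxE => ->; rewrite subrr.
Qed.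

Lemma subm_self (m : 'X_{1..2}) : (m - m)%MM = 0%MM.
Proof. by apply/mnmP => i; rewrite !mnmE subnn. Qed.

Lemma mderiv_comp_mpoly (t : 2.-tuple {mpoly K[2]}) (p : {mpoly K[2]}) j :
  (p \mPo t)^`M(j) = \sum_i (p^`M(i) \mPo t) * (tnth t i)^`M(j).
Proof.
pose P (p : {mpoly K[2]}) :=
  (p \mPo t)^`M(j) = \sum_i (p^`M(i) \mPo t) * (tnth t i)^`M(j).
have PM a b : P a -> P b -> P (a * b).
  rewrite /P => Pa Pb; rewrite rmorphM mderivM Pa Pb mulr_suml mulr_sumr.
  rewrite -big_split; apply: eq_bigr => i _ /=.
  by rewrite mderivM rmorphD !rmorphM mulrDl mulrAC mulrA.
have PC c : P c%:MP.
  rewrite /P comp_mpolyC mderivC big1 // => i _.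
  by rewrite mderivC comp_mpoly0 mul0r.
have P1 : P 1 by exact: (PC 1).
have PX i : P 'X_i.
  rewrite /P comp_mpolyXU -tnth_nth (bigD1 i) //= mderivX mnm1E eqxx.
  rewrite scale1r subm_self mpolyX0 comp_mpoly1 mul1r big1 ?addr0 // => k nk.
  by rewrite mderivX mnm1E eq_sym (negbTE nk) scale0r comp_mpoly0 mul0r.
elim/mpolyind: p => [|c m p _ _ IHp]; first exact: (PC 0).
have Pm : P 'X_[m].
  rewrite mpolyXE_id; apply: (big_ind P) => // i _.
  by elim: (m i) => [|k IHk]; rewrite ?expr0 ?exprS //; apply: PM.
have Pcm : P (c *: 'X_[m]) by rewrite -mul_mpolyC; apply: PM.
rewrite comp_mpolyD mderivD Pcm IHp -big_split; apply: eq_bigr => i _ /=.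
by rewrite mderivD comp_mpolyD mulrDl.
Qed.

Lemma poly_map_comp F G :
  poly_map F \o poly_map G = poly_map (fun i => F i \mPo [tuple G i | i < 2]).
Proof.
apply/funext => z; apply/rowP => i; rewrite !mxE comp_mpoly_meval.
by apply: meval_eq => k; rewrite !mxE tnth_mktuple.
Qed.

Lemma poly_map_id : id = poly_map (fun i => 'X_i).
Proof. by apply/funext => z; apply/rowP => i; rewrite mxE mevalXU. Qed.

Lemma jacobian_det_comp F G :
  jacobian_det (fun i => F i \mPo [tuple G i | i < 2]) =
  (jacobian_det F \mPo [tuple G i | i < 2]) * jacobian_det G.
Proof.
rewrite /jacobian_det -(det_map_mx (comp_mpoly [tuple G i | i < 2])).
rewrite -det_mulmx; congr (\det _); apply/matrixP => i j; rewrite !mxE.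
rewrite mderiv_comp_mpoly; apply: eq_bigr => k _.
by rewrite !mxE tnth_mktuple.
Qed.

Lemma jacobian_det_id : jacobian_det (fun i => 'X_i) = 1.
Proof.
rewrite /jacobian_det -[RHS](det1 _ 2); congr (\det _).
apply/matrixP => i j; rewrite !mxE mderivX mnm1E.
case: eqP => [->|_]; last by rewrite scale0r.
by rewrite scale1r subm_self mpolyX0.
Qed.

Lemma is_poly_aut_id : is_poly_aut id.
Proof.
have id_poly : is_poly_map id by exists (fun i => 'X_i); exact: poly_map_id.
by split=> //; exists id.
Qed.

Lemma has_jacobian1_id : has_jacobian1 id.
Proof.
exists (fun i => 'X_i); split; [exact: poly_map_id | exact: jacobian_det_id].
Qed.

Lemma is_poly_map_comp f g :
  is_poly_map f -> is_poly_map g -> is_poly_map (f \o g).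
Proof. by move=> [F ->] [G ->]; eexists; apply: poly_map_comp. Qed.

Lemma is_poly_aut_comp f g :
  is_poly_aut f -> is_poly_aut g -> is_poly_aut (f \o g).
Proof.
move=> [Pf [f' [Pf' fK f'K]]] [Pg [g' [Pg' gK g'K]]].
split; first exact: is_poly_map_comp.
exists (g' \o f'); split; first exact: is_poly_map_comp.
- exact: can_comp fK gK.
- exact: can_comp g'K f'K.
Qed.

Lemma has_jacobian1_comp f g :
  has_jacobian1 f -> has_jacobian1 g -> has_jacobian1 (f \o g).
Proof.
move=> [F [-> jF]] [G [-> jG]]; eexists; split; first exact: poly_map_comp.
by rewrite jacobian_det_comp jF jG comp_mpoly1 mulr1.
Qed.

Lemma has_jacobian1_inv f g :
  is_poly_map g -> cancel g f -> cancel f g -> has_jacobian1 f ->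
  has_jacobian1 g.
Proof.
move=> [G eg] gK fK [F [ef jF]]; exists G; split=> //.
have fg1 : poly_map F \o poly_map G = id.
  by rewrite -eg -ef; apply/funext => z; exact: gK.
rewrite poly_map_comp poly_map_id in fg1.
have := jacobian_det_id; rewrite -(poly_map_inj fg1) jacobian_det_comp jF.
by rewrite comp_mpoly1 mul1r.
Qed.

Record SAut2 := MkSAut2 {
  SAut2_fun :> 'rV[K]_2 -> 'rV[K]_2;
  SAut2_aut : is_poly_aut SAut2_fun;
  SAut2_jac : has_jacobian1 SAut2_fun }.

Lemma SAut2_eq (f g : SAut2) : SAut2_fun f = SAut2_fun g -> f = g.
Proof.
case: f g => [f af jf] [g ag jg] /= eq_fg; case: _ / eq_fg ag jg => ag jg.
by congr MkSAut2; exact: Prop_irrelevance.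
Qed.

HB.instance Definition _ := gen_eqMixin SAut2.
HB.instance Definition _ := gen_choiceMixin SAut2.

Definition SAut2_one : SAut2 := MkSAut2 is_poly_aut_id has_jacobian1_id.

Definition SAut2_mul (f g : SAut2) : SAut2 :=
  MkSAut2 (is_poly_aut_comp (SAut2_aut f) (SAut2_aut g))
          (has_jacobian1_comp (SAut2_jac f) (SAut2_jac g)).

Lemma SAut2_inv_subproof (f : SAut2) :
  exists g : SAut2, cancel f g /\ cancel g f.
Proof.
case: f => f [[F eF] [g [Pg fK gK]]] jf.
have ag : is_poly_aut g by split=> //; exists f; split=> //; exists F.
by exists (MkSAut2 ag (has_jacobian1_inv Pg gK fK jf)).
Qed.

Definition SAut2_inv (f : SAut2) : SAut2 := projT1 (cid (SAut2_inv_subproof f)).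

Lemma SAut2_mulA : associative SAut2_mul.
Proof. by move=> f g h; apply: SAut2_eq. Qed.
Lemma SAut2_1mul : left_id SAut2_one SAut2_mul.
Proof. by move=> f; apply: SAut2_eq. Qed.
Lemma SAut2_mul1 : right_id SAut2_one SAut2_mul.
Proof. by move=> f; apply: SAut2_eq. Qed.
Lemma SAut2_Vmul : left_inverse SAut2_one SAut2_inv SAut2_mul.
Proof.
move=> f; apply: SAut2_eq; apply/funext => z /=.
by rewrite /SAut2_inv; case: cid => g [fK gK] /=; rewrite fK.
Qed.
Lemma SAut2_mulV : right_inverse SAut2_one SAut2_inv SAut2_mul.
Proof.
move=> f; apply: SAut2_eq; apply/funext => z /=.
by rewrite /SAut2_inv; case: cid => g [fK gK] /=; rewrite gK.
Qed.

HB.instance Definition _ := isGroup.Build SAut2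
  SAut2_mulA SAut2_1mul SAut2_mul1 SAut2_Vmul SAut2_mulV.

Lemma SAut2_mulE (f g : SAut2) z : (f * g)%g z = f (g z).
Proof. by []. Qed.

End PolynomialMaps.

(* Main.v *)
Require Import Defs.
From mathcomp Require Import all_boot all_order all_algebra fingroup.
From mathcomp Require Import reals complex.
From mathcomp Require Import boolp mpoly ring zify.

(** The proof combines two independent facts.

    Generation (Jung). The group [SAut2 K] is generated by the shears, which
    add to one coordinate a polynomial in the other ([SAut2_shear_ind]). Take
    an automorphism with components [f], [g] and Jacobian [1], and measure
    polynomials by their leading monomial in the degree-lexicographic order.
    If the leading monomial of one component is a power of that of the other,
    subtracting a multiple of a power of the latter, i.e. composing with a
    shear, lowers it. If not, [x] and [y] are still polynomials in [f] and [g],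
    and the degree estimate [mlead_subst_estimate], a variant of the one of
    Shestakov and Umirbaev, shows that hardly anything can cancel in such an
    expression: the Jacobian being [1], each order of cancellation costs only
    a bounded amount, whereas it requires a large power of [g]. So the leading
    monomials of [f] and [g] are [x] and [y] in some order; the map is affine,
    and an affine map of determinant [1] is a product of shears by elimination.

    Representations. Fix a coordinate. The shears along it form a copy of the
    additive group [K[x]], and a translation of the other coordinate acts on
    it by the shift [P(x) -> P(x + 1)] ([shear_translate]). Every
    finite-dimensional representation of [K[x]] that extends to the shift is
    trivial on [K[x]] ([shifted_representation_trivial]). The reason is that
    the difference operator [P(x + 1) - P(x)] is at once surjective on [K[x]]
    and nilpotent on each polynomial, while in finite dimension a nilpotent
    orbit dies after boundedly many steps. This is used twice: the characters
    of [K[x]] that occur are trivial, since the shift would move any other one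
    through infinitely many values; and an extension of trivial
    representations is given by an additive map out of [K[x]] that is
    equivariant for the shift, hence zero ([additive_shift_eq0]). A flag is
    then built one vector at a time, working with eigenvectors modulo the part
    already known to be fixed, which avoids passing to quotient spaces.

    A representation of [SAut2 K] is therefore trivial on all shears, along
    either coordinate, hence on the group that they generate. *)

Set Implicit Arguments.
Unset Strict Implicit.
Unset Printing Implicit Defensive.

Import Order.TTheory GRing.Theory Num.Theory.
Local Open Scope ring_scope.

(** * The difference operator on polynomials *)

Section Difference.
Context (K : numFieldType).
Implicit Types P Q : {poly K}.

Definition shift_poly P : {poly K} := P \Po ('X + 1).

Definition diff_poly P : {poly K} := shift_poly P - P.

Lemma size_shift_poly P : size (shift_poly P) = size P.
Proof. by rewrite size_comp_poly2 // -[1]opprK -polyCN size_XsubC. Qed.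

Lemma shift_polyD P Q : shift_poly (P + Q) = shift_poly P + shift_poly Q.
Proof. exact: comp_polyD. Qed.

Lemma size_diff_poly d P : (size P <= d.+1)%N -> (size (diff_poly P) <= d)%N.
Proof.
move=> szP; apply/leq_sizeP => j; rewrite leq_eqVlt => /predU1P[<-|ltdj].
  have [szlt|] := ltnP (size P) d.+1.
    by rewrite coefB !nth_default ?subrr ?size_shift_poly // -ltnS.
  rewrite leq_eqVlt ltnNge szP orbF => /eqP eqP.
  have sX : size ('X + 1 : {poly K}) = 2%N.
    by rewrite -[1]opprK -polyCN size_XsubC.
  have lX : lead_coef ('X + 1 : {poly K}) = 1.
    by rewrite -[1]opprK -polyCN lead_coefXsubC.
  have := @lead_coef_comp _ P ('X + 1).
  rewrite lX expr1n mulr1 sX => /(_ isT).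
  rewrite !lead_coefE -/(shift_poly P) size_shift_poly -eqP /=.
  by rewrite coefB => ->; rewrite subrr.
by rewrite coefB !nth_default ?subrr ?size_shift_poly // (leq_trans szP).
Qed.

Lemma diff_polyD P Q : diff_poly (P + Q) = diff_poly P + diff_poly Q.
Proof. by rewrite /diff_poly /shift_poly comp_polyD opprD addrACA. Qed.

Lemma diff_polyZ c P : diff_poly (c *: P) = c *: diff_poly P.
Proof. by rewrite /diff_poly /shift_poly comp_polyZ scalerBr. Qed.

(** The difference of ['X^(d+1)] is a sum of [d + 1] monic polynomials of degree
    [d], so in characteristic zero leading terms can be removed one by one. *)
Lemma diff_poly_surj P : exists Q, diff_poly Q = P.
Proof.
have mon a b : ('X + 1) ^+ a * 'X^b \is @monic K.
  by rewrite monicMl ?monicXn // monic_exp // -[1]opprK -polyCN monicXsubC.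
have szm a b : size (('X + 1) ^+ a * 'X^b : {poly K}) = (a + b).+1.
  rewrite size_monicM ?monicXn //; last by rewrite -size_poly_eq0 size_polyXn.
    by rewrite size_polyXn -[1]opprK -polyCN size_exp_XsubC /= addnS.
  by rewrite monic_exp // -[1]opprK -polyCN monicXsubC.
elim: (size P) {-2}P (leqnn (size P)) => {P} [|d IHd] P szP.
  move: szP; rewrite leqn0 size_poly_eq0 => /eqP->.
  by exists 0; rewrite /diff_poly /shift_poly comp_poly0 subr0.
pose c := P`_d / d.+1%:R; pose L : {poly K} := c *: 'X^(d.+1).
have eL : diff_poly L = c *: \sum_(i < d.+1) ('X + 1) ^+ (d - i) * 'X^i.
  rewrite diff_polyZ /diff_poly /shift_poly comp_Xn_poly subrXX.
  by rewrite addrAC subrr add0r mul1r.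
suff szR : (size (P - diff_poly L)%R <= d)%N.
  by have [Q eQ] := IHd _ szR; exists (Q + L); rewrite diff_polyD eQ subrK.
apply/leq_sizeP => j; rewrite leq_eqVlt eL coefB coefZ coef_sum.
move=> /predU1P[<-|ltdj]; last first.
  rewrite nth_default ?(leq_trans szP) // sub0r big1 ?mulr0 ?oppr0 // => i _.
  by rewrite nth_default // szm subnK // -ltnS.
under eq_bigr => i _.
  have -> : (('X + 1) ^+ (d - i) * 'X^i : {poly K})`_d = 1.
    have := monicP (mon (d - i)%N i).
    by rewrite lead_coefE szm subnK // -ltnS.
  over.
by rewrite sumr_const card_ord mulfVK ?pnatr_eq0 // subrr.
Qed.

End Difference.

(** * Eigenvectors modulo an invariant subspace *)

Section CommonEigenvectors.
Context (K : fieldType) (n : nat).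
Implicit Types (X Y M : 'M[K]_n.+1) (v w : 'rV[K]_n.+1).

Lemma scale_submx a v X : ~~ (v <= X)%MS -> (a *: v <= X)%MS -> a = 0.
Proof.
move=> nvX; have [-> //|a0] := eqVneq a 0.
by rewrite (eqmx_scale _ a0) (negbTE nvX).
Qed.

Lemma horner_mx_mod v X M (a : K) (p : {poly K}) :
  stablemx X M -> (v *m M - a *: v <= X)%MS ->
  (v *m horner_mx M p - p.[a] *: v <= X)%MS.
Proof.
move=> XM va; elim/poly_ind: p => [|p c IHp].
  by rewrite rmorph0 horner0 mulmx0 scale0r subr0 sub0mx.
rewrite rmorphD rmorphM /= horner_mx_X horner_mx_C hornerMXaddC.
rewrite mulmxDr mulmxA mul_mx_scalar scalerDl opprD addrACA subrr addr0.
have := addmx_sub (submx_trans (submxMr M IHp) XM) (scalemx_sub p.[a] va).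
by rewrite mulmxBl -scalemxAl scalerBr scalerA addrA subrK.
Qed.

Lemma root_char_poly_mod v X M (a : K) :
  stablemx X M -> ~~ (v <= X)%MS -> (v *m M - a *: v <= X)%MS ->
  root (char_poly M) a.
Proof.
move=> XM nvX /(horner_mx_mod (char_poly M) XM).
rewrite Cayley_Hamilton mulmx0 sub0r eqmx_opp => /(scale_submx nvX) e.
exact/rootP.
Qed.

End CommonEigenvectors.

Section ClosedField.
Context (K : closedFieldType) (n : nat).
Implicit Types (X Y M : 'M[K]_n.+1) (v w : 'rV[K]_n.+1).

(** Apply the linear factors of the characteristic polynomial to [v] in turn: the
    product kills [v], so some factor is the first to send the current vector
    into [X]. The predicate [V], a subspace stable under [M], need not be given
    by a matrix; this matters when it is cut out by infinitely many
    conditions. *)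
Lemma eigenvector_mod (V : 'rV[K]_n.+1 -> Prop) X M v :
  (forall w a, V w -> V (w *m M - a *: w)) -> V v -> ~~ (v <= X)%MS ->
  exists w a, [/\ V w, ~~ (w <= X)%MS & (w *m M - a *: w <= X)%MS].
Proof.
move=> VM; have [r er] := closed_field_poly_normal (char_poly M).
have : (v *m horner_mx M (\prod_(z <- r) ('X - z%:P)) <= X)%MS.
  have := Cayley_Hamilton M; rewrite er (monicP (char_poly_monic M)) scale1r.
  by move->; rewrite mulmx0 sub0mx.
elim: r v {er} => [|a r IHr] v.
  by rewrite big_nil rmorph1 mulmx1 => ->.
rewrite big_cons rmorphM rmorphB /= horner_mx_X horner_mx_C mulmxA mulmxBr.
rewrite mul_mx_scalar => vX Vv nvX.
have [w_in|w_out] := boolP (v *m M - a *: v <= X)%MS; first by exists v, a.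
exact: IHr (VM _ _ Vv) w_out.
Qed.

(** Induction on the rank of [Y]: either every [A i] is a scalar on [Y] modulo [X],
    or some [A i] is not, and then one of its eigenspaces in [Y] modulo [X] is a
    strictly smaller subspace, stable because the family commutes. *)
Lemma common_eigenvector_mod (I : Type) (A : I -> 'M[K]_n.+1) X Y :
  (forall i j, A i *m A j = A j *m A i) -> (forall i, stablemx X (A i)) ->
  (forall i, stablemx Y (A i)) -> ~~ (Y <= X)%MS ->
  exists v (chi : I -> K),
    ~~ (v <= X)%MS /\ forall i, (v *m A i - chi i *: v <= X)%MS.
Proof.
move=> Acomm XA; have [r] := ubnP (\rank Y).
elim: r Y => // r IHr Y rY YA nYX.
have [[chi Hchi]|] := pselect (exists chi : I -> K,
    forall i, (Y *m (A i - (chi i)%:M) <= X)%MS).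
  have /row_subPn[k nk] := nYX; exists (row k Y), chi; split=> // i.
  apply: submx_trans (Hchi i); rewrite -mul_mx_scalar -mulmxBr -row_mul.
  exact: row_sub.
move=> nchi; have [i Hi] : exists i, forall a, ~~ (Y *m (A i - a%:M) <= X)%MS.
  apply: contrapT => nex; apply: nchi.
  have /choice[chi Hchi] : forall i, exists a, (Y *m (A i - a%:M) <= X)%MS.
    move=> i; apply: contrapT => na; apply: nex; exists i => a.
    by apply/negP => h; apply: na; exists a.
  by exists chi.
have /row_subPn[k nk] := nYX.
have [w [a [wY nwX wa]]] : exists w a,
    [/\ (w <= Y)%MS, ~~ (w <= X)%MS & (w *m A i - a *: w <= X)%MS].
  apply: (eigenvector_mod (V := fun w => (w <= Y)%MS) _ (row_sub k Y) nk).
  move=> w a wY; rewrite addmx_sub ?eqmx_opp ?scalemx_sub //.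
  exact: submx_trans (submxMr _ wY) (YA i).
pose Z := (Y :&: kermx ((A i - a%:M) *m cokermx X))%MS.
have inZ m (B : 'M_(m, n.+1)) :
    (B <= Z)%MS = (B <= Y)%MS && (B *m (A i - a%:M) <= X)%MS.
  by rewrite sub_capmx (sameP sub_kermxP eqP) mulmxA -submxE.
have /andP[ZY ZX] : (Z <= Y)%MS && (Z *m (A i - a%:M) <= X)%MS by rewrite -inZ.
apply: (IHr Z).
- suff ltr : (\rank Z < \rank Y)%N by exact: leq_trans ltr rY.
  by apply: rank_ltmx; rewrite ltmxE ZY inZ submx_refl (negbTE (Hi a)).
- move=> j; rewrite inZ (submx_trans (submxMr _ ZY) (YA j)) /=.
  rewrite -mulmxA; have -> : A j *m (A i - a%:M) = (A i - a%:M) *m A j.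
    by rewrite mulmxBr mulmxBl Acomm scalar_mxC.
  by rewrite mulmxA (submx_trans (submxMr _ ZX) (XA j)).
- apply: contra nwX => ZsX; apply: submx_trans ZsX.
  by rewrite inZ wY mulmxBr mul_mx_scalar.
Qed.

End ClosedField.

(** * Representations of the additive group of polynomials with a shift *)

Section AdditiveShift.
Context (K : numFieldType) (n : nat).
Context (phi : {poly K} -> 'rV[K]_n.+1) (S : 'M[K]_n.+1).
Hypothesis phiD : forall P Q : {poly K}, phi (P + Q) = phi P + phi Q.
Hypothesis phiS : forall P, phi (shift_poly P) = phi P *m S.

(** With [M := S - 1], each [phi P] is killed by a power of [M], because taking
    differences kills [P], and is a value of [M ^+ k] for all [k], because taking
    differences is surjective. Writing the characteristic polynomial of [M] as
    [q * 'X^k] with [q] prime to ['X], the second fact puts [phi P] in the kernel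
    of [q], and coprimality with the power of ['X] gives zero. *)
Lemma additive_shift_eq0 P : phi P = 0.
Proof.
have phi0 : phi 0 = 0 by apply: (addrI (phi 0)); rewrite -phiD !addr0.
pose M := S - 1%:M.
have phiM (Q : {poly K}) : phi (diff_poly Q) = phi Q *m M.
  by apply: (addIr (phi Q)); rewrite -phiD subrK phiS mulmxBr mulmx1 subrK.
have nilM d (Q : {poly K}) : (size Q <= d)%N -> phi Q *m M ^+ d = 0.
  elim: d Q => [|d IHd] Q szQ.
    by move: szQ; rewrite leqn0 size_poly_eq0 => /eqP->; rewrite phi0 mul0mx.
  by rewrite exprS mulmxA -phiM; apply: IHd; exact: size_diff_poly.
have surjM k : exists Q, phi P = phi Q *m M ^+ k.
  elim: k => [|k [Q eQ]]; first by exists P; rewrite expr0 mulmx1.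
  by have [R eR] := diff_poly_surj Q; exists R; rewrite exprS mulmxA -phiM eR.
have [k [q]] := multiplicity_XsubC (char_poly M) 0.
rewrite monic_neq0 ?char_poly_monic //= subr0 => q0 eq_ch.
have qP : phi P *m horner_mx M q = 0.
  (* [phi P = phi Q *m M ^+ k], and [M ^+ k * q(M)] is zero. *)
  have [Q ->] := surjM k.
  have := Cayley_Hamilton M; rewrite eq_ch rmorphM rmorphXn /= horner_mx_X.
  have -> : horner_mx M q * M ^+ k = M ^+ k * horner_mx M q.
    by apply: commrX; apply: comm_horner_mx.
  by rewrite -mulmxA => e; rewrite [M ^+ k *m _]e mulmx0.
have /Bezout_eq1_coprimepP[[u v] /= uv1] : coprimep q ('X ^+ size P).
  by apply: coprimep_expr; rewrite -[X in coprimep q X]subr0 coprimep_XsubC.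
rewrite -[phi P]mulmx1 -[1%:M](rmorph1 (horner_mx M)) -uv1.
rewrite (mulrC u) (mulrC v) rmorphD !rmorphM rmorphXn /= horner_mx_X.
by rewrite mulmxDr !mulmxA qP (nilM _ P) // !mul0mx addr0.
Qed.

End AdditiveShift.

Section ShiftedRepresentation.
Context (K : numClosedFieldType) (n : nat).
Context (A : {poly K} -> 'M[K]_n.+1) (T : 'M[K]_n.+1).
Hypothesis A0 : A 0 = 1%:M.
Hypothesis AD : forall P Q : {poly K}, A (P + Q) = A P *m A Q.
Hypothesis T_unit : T \in unitmx.
Hypothesis AT : forall P, T *m A P = A (shift_poly P) *m T.
Implicit Types (X : 'M[K]_n.+1) (v w : 'rV[K]_n.+1) (P Q : {poly K}).

Let T_free : row_free T. Proof. by rewrite row_free_unit. Qed.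

Let stable_cancel m (B : 'M_(m, n.+1)) X :
  stablemx X T -> (B *m T <= X)%MS = (B <= X)%MS.
Proof.
move=> XT; have eXT : (X *m T :=: X)%MS.
  by apply/eqmxP; rewrite -(geq_leqif (mxrank_leqif_eq XT)) mxrankMfree.
by rewrite -eXT submxMfree.
Qed.

(** By induction on the degree of [P]. Write [P] as the difference of some [R]:
    as [chi] is trivial in lower degrees, the [i]-th shift of [R] has character
    [chi R * chi P ^+ i]. All these numbers are eigenvalues of the single matrix
    [A R], so [chi P] is a root of unity of bounded order, for every [P] of the
    given degree; dividing [P] by a multiple of all possible orders shows that
    [chi P = 1]. *)
Lemma shifted_character_eq1 X v (chi : {poly K} -> K) :
  stablemx X T -> (forall P, stablemx X (A P)) -> ~~ (v <= X)%MS ->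
  (forall P, (v *m A P - chi P *: v <= X)%MS) -> forall P, chi P = 1.
Proof.
move=> XT XA nvX vA.
have chiD P Q : chi (P + Q) = chi P * chi Q.
  apply/eqP; rewrite -subr_eq0; apply/eqP; apply: (scale_submx nvX).
  have h1 := vA (P + Q).
  have h2 := submx_trans (submxMr (A Q) (vA P)) (XA Q).
  have h3 := scalemx_sub (chi P) (vA Q).
  rewrite -eqmx_opp in h1; have := addmx_sub (addmx_sub h2 h3) h1.
  rewrite AD mulmxA mulmxBl scalerBr -scalemxAl scalerA addrA subrK opprB.
  by rewrite [Y in (Y <= _)%MS -> _]addrC addrA subrK scalerBl.
have chi0 : chi 0 = 1.
  apply/eqP; rewrite -subr_eq0 -oppr_eq0 opprB; apply/eqP.
  apply: (scale_submx nvX).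
  by have := vA 0; rewrite A0 mulmx1 scalerBl scale1r.
have chi_neq0 P : chi P != 0.
  apply/eqP => cP0; have := chiD P (- P).
  by rewrite subrr chi0 cP0 mul0r => /eqP; rewrite oner_eq0.
have chiMn P k : chi (P *+ k) = chi P ^+ k.
  by elim: k => [|k IHk]; rewrite ?mulr0n // mulrS chiD IHk exprS.
have orbit i Q : root (char_poly (A Q)) (chi (iter i (@shift_poly K) Q)).
  apply: (@root_char_poly_mod _ _ (v *m T ^+ i) X _ _ (XA Q)).
    by elim: i => [|i IHi]; rewrite ?expr0 ?mulmx1 // exprSr mulmxA stable_cancel.
  elim: i Q => [|i IHi] Q; first by rewrite expr0 mulmx1.
  rewrite exprSr mulmxA -[_ *m T *m _]mulmxA AT mulmxA iterSr.
  by rewrite scalemxAl -mulmxBl stable_cancel.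
(* A common multiple of all differences of two indices below [n.+2]. *)
have [N N_gt0 HN] : exists2 N, (0 < N)%N &
    forall i, (0 < i < n.+2)%N -> (i %| N)%N.
  by exists (n.+1)`!; rewrite ?fact_gt0 // => i ?; apply: dvdn_fact.
move=> P; elim: (size P) {-2}P (leqnn (size P)) => {P} [|d IHd] P szP.
  by move: szP; rewrite leqn0 size_poly_eq0 => /eqP->.
have chiN Q : (size Q <= d.+1)%N -> chi Q ^+ N = 1.
  move=> szQ; have [R eR] := diff_poly_surj Q.
  have it i : chi (iter i (@shift_poly K) R) = chi R * chi Q ^+ i.
    elim: i => [|i IHi]; first by rewrite expr0 mulr1.
    have itD U V : iter i (@shift_poly K) (U + V) =
        iter i (@shift_poly K) U + iter i (@shift_poly K) V.
      by elim: i {IHi} => // i IHi; rewrite !iterS IHi shift_polyD.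
    have [_ itQ] : (size (iter i (@shift_poly K) Q) <= d.+1)%N /\
        chi (iter i (@shift_poly K) Q) = chi Q.
      elim: i {IHi itD} => // i [sz IHi]; rewrite iterS size_shift_poly; split=> //.
      rewrite -[shift_poly _](subrK (iter i (@shift_poly K) Q)) chiD IHi.
      by rewrite IHd ?mul1r // size_diff_poly.
    rewrite iterSr -[shift_poly R](subrK R) -/(diff_poly R) eR itD chiD IHi itQ.
    by rewrite mulrC exprSr mulrA.
  (* [n.+2] eigenvalues of a matrix of size [n.+1] cannot be distinct. *)
  have : ~~ uniq [seq chi R * chi Q ^+ i | i <- iota 0 n.+2].
    apply/negP => u; have := max_poly_roots (monic_neq0 (char_poly_monic (A R))) _ u.
    rewrite size_char_poly size_map size_iota ltnn => h; apply/notF/h.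
    by apply/allP => _ /mapP[i _ ->]; rewrite -it.
  case/(uniqPn 0) => i [j []]; rewrite size_map size_iota => lij lj.
  rewrite !(nth_map 0%N) ?size_iota ?(ltn_trans lij) // !nth_iota ?(ltn_trans lij) //.
  rewrite !add0n => /(mulfI (chi_neq0 R)); rewrite -{1}(subnKC (ltnW lij)) exprD.
  rewrite -[LHS]mulr1 => /(mulfI (expf_neq0 _ (chi_neq0 Q))) e1.
  have /dvdnP[k ->] : (j - i %| N)%N.
    by apply: HN; rewrite subn_gt0 lij (leq_ltn_trans (leq_subr _ _)).
  by rewrite mulnC exprM -e1 expr1n.
have -> : P = (N%:R^-1 *: P) *+ N.
  by rewrite -scaler_nat scalerA mulfV ?scale1r // pnatr_eq0 -lt0n.
by rewrite chiMn chiN // (leq_trans (size_scale_leq _ _)).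
Qed.

(** The set of [v] with [v *m A P - v] in [X] for all [P] is stable under [T] and
    is not contained in [X], by triviality of characters. Take in it an
    eigenvector [w] of [T] modulo [X]. Since [A] is trivial on [X], the map
    [P |-> w *m A P - w] is additive, and conjugation by [T] makes it equivariant
    for the shift; hence it vanishes. *)
Lemma shifted_representation_extend X :
  stablemx X T -> (forall P, X *m A P = X) -> ~~ (1%:M <= X)%MS ->
  exists2 v : 'rV[K]_n.+1, ~~ (v <= X)%MS &
    (v *m T <= X + v)%MS /\ forall P, v *m A P = v.
Proof.
move=> XT XA1 nX1.
have XA P : stablemx X (A P) by rewrite XA1.
have Acomm P Q : A P *m A Q = A Q *m A P by rewrite -!AD addrC.
have [v [chi [nvX vA]]] : exists v (chi : {poly K} -> K),
    ~~ (v <= X)%MS /\ forall P, (v *m A P - chi P *: v <= X)%MS.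
  by apply: (common_eigenvector_mod Acomm XA _ nX1) => P; rewrite submx1.
have chi1 := shifted_character_eq1 XT XA nvX vA.
pose V (w : 'rV[K]_n.+1) := forall P, (w *m A P - w <= X)%MS.
have VT w : V w -> V (w *m T).
  by move=> Vw P; rewrite -mulmxA AT mulmxA -mulmxBl stable_cancel.
have [w [a [Vw nwX wT]]] : exists w a,
    [/\ V w, ~~ (w <= X)%MS & (w *m T - a *: w <= X)%MS].
  apply: (eigenvector_mod _ _ nvX) => [w a Vw P|P]; last first.
    by have := vA P; rewrite chi1 scale1r.
  rewrite mulmxBl -scalemxAl opprD addrACA -opprD -scalerBr.
  by rewrite addmx_sub ?VT // eqmx_opp scalemx_sub.
exists w => //; split.
  rewrite -[w *m T](subrK (a *: w)) addmx_sub //.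
    exact: submx_trans wT (addsmxSl _ _).
  by rewrite scalemx_sub // addsmxSr.
pose phi P := w *m A P - w.
have fixX m (B : 'M_(m, n.+1)) P : (B <= X)%MS -> B *m A P = B.
  by case/submxP => D ->; rewrite -mulmxA XA1.
move=> P; apply/eqP; rewrite -subr_eq0 -/(phi P); apply/eqP.
apply: (@additive_shift_eq0 _ _ phi (a *: invmx T)) => [{}P Q|{}P] /=.
  rewrite /phi AD mulmxA -{1}[w *m A P](subrK w) mulmxDl fixX //.
  by rewrite addrA.
apply: (can_inj (mulmxK T_unit)).
rewrite -mulmxA -scalemxAl mulVmx // -scalemxAr mulmx1.
rewrite /phi mulmxBl -mulmxA -AT mulmxA -[w *m T](subrK (a *: w)).
by rewrite mulmxDl fixX // -scalemxAl opprD addrACA subrr add0r -scalerBr.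
Qed.

Theorem shifted_representation_trivial P : A P = 1%:M.
Proof.
have grow r : (r <= n.+1)%N -> exists2 X : 'M[K]_n.+1, stablemx X T &
    (forall Q, X *m A Q = X) /\ (r <= \rank X)%N; last first.
  have [X _ [XA rX]] := grow _ (leqnn _).
  have Xu : X \in unitmx by rewrite -row_full_unit -col_leq_rank.
  by apply: (can_inj (mulKmx Xu)); rewrite XA mulmx1.
elim: r => [_|r IHr ltr].
  by exists 0; rewrite ?mul0mx ?sub0mx //; split=> // Q; rewrite mul0mx.
have [X XT [XA rX]] := IHr (ltnW ltr).
have [X1|nX1] := boolP (1%:M <= X)%MS.
  exists X => //; split=> //; move: X1; rewrite sub1mx -col_leq_rank.
  exact: leq_trans.
have [v nvX [vT vA]] := shifted_representation_extend XT XA nX1.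
exists (X + v)%MS.
  by rewrite addsmxMr addsmx_sub vT (submx_trans XT) // addsmxSl.
split=> [Q|].
  have /sub_addsmxP[[D E] ->] := submx_refl (X + v)%MS.
  by rewrite mulmxDl -!mulmxA XA vA.
apply: leq_ltn_trans rX _.
by apply: rank_ltmx; rewrite ltmxE addsmxSl addsmx_sub submx_refl.
Qed.

End ShiftedRepresentation.

(** * Two-dimensional preliminaries and shears *)

Definition other : 'I_2 -> 'I_2 := @rev_ord 2.

Lemma other_neq i : (other i == i) = false.
Proof. by case: i => [[|[|//]] ?]. Qed.

Lemma otherK : involutive other.
Proof. exact: rev_ordK. Qed.

Lemma ord2P i (k : 'I_2) : k = i \/ k = other i.
Proof.
by case: i k => [[|[|//]] ?] [[|[|//]] ?]; [left|right|right|left];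
  apply: val_inj.
Qed.

Lemma big_ord2 (V : Type) (idx : V) (op : Monoid.com_law idx) i (f : 'I_2 -> V) :
  \big[op/idx]_k f k = op (f i) (f (other i)).
Proof.
rewrite (bigD1 i) //= (bigD1 (other i)) /= ?other_neq // big1 ?Monoid.mulm1 //.
by move=> k /andP[]; case: (ord2P i k) => ->; rewrite eqxx // andbF.
Qed.

Lemma det_mx22 (R : comPzRingType) (M : 'M[R]_2) :
  \det M = M ord0 ord0 * M ord_max ord_max - M ord0 ord_max * M ord_max ord0.
Proof.
have e0 : lift ord0 0 = ord_max :> 'I_2 by apply: val_inj.
have e1 : lift ord_max 0 = ord0 :> 'I_2 by apply: val_inj.
rewrite (expand_det_row _ ord0) big_ord_recl big_ord1 /cofactor !det_mx11.
by rewrite !mxE e0 e1 expr0 mul1r expr1 mulN1r mulrN.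
Qed.

Section Shears.
Context (K : numFieldType).
Implicit Types (F : 'I_2 -> {mpoly K[2]}) (P Q : {poly K}) (i j : 'I_2).

(** The formula is the same for both values of [i], so that the two coordinates can
    be treated alike below. *)
Lemma jacobian_detE i F :
  jacobian_det F = (F i)^`M(i) * (F (other i))^`M(other i)
                 - (F i)^`M(other i) * (F (other i))^`M(i).
Proof.
rewrite /jacobian_det det_mx22 !mxE.
have [->|->] := ord2P ord0 i; rewrite ?otherK.
  by have -> : other ord0 = ord_max by apply: val_inj.
have -> : other ord0 = ord_max by apply: val_inj.
by rewrite mulrC [X in _ - X]mulrC.
Qed.

Lemma jacobian_det_fix i F :
  F (other i) = 'X_(other i) -> jacobian_det F = (F i)^`M(i).
Proof.
move=> eF; rewrite (jacobian_detE i) eF !mderivX !mnm1E eqxx other_neq.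
by rewrite subm_self mpolyX0 scale0r mulr0 subr0 scale1r mulr1.
Qed.

Lemma mderiv_map_poly j P :
  ((map_poly (@mpolyC 2 K) P).['X_j])^`M(other j) = 0.
Proof.
elim/poly_ind: P => [|P c IHP].
  by rewrite map_poly0 horner0 mderiv0.
rewrite rmorphD rmorphM /= map_polyX map_polyC hornerMXaddC mderivD mderivM.
by rewrite IHP mderivC mderivX mnm1E eq_sym other_neq scale0r mul0r mulr0 !addr0.
Qed.

Definition shear_fun i P (z : 'rV[K]_2) : 'rV[K]_2 :=
  z + P.[z 0 (other i)] *: delta_mx 0 i.

Lemma shear_comp_poly_map i P F :
  shear_fun i P \o poly_map F = poly_map (fun k =>
    F k + (if k == i then (map_poly (@mpolyC 2 K) P).[F (other i)] else 0)).
Proof.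
apply/funext => z /=; apply/rowP => k; rewrite /shear_fun !mxE mevalD eqxx /=.
case: (k == i); rewrite ?mulr0 ?meval0 // mulr1; congr (_ + _).
rewrite -horner_map -map_poly_comp map_poly_id // => c _ /=.
by rewrite mevalC.
Qed.

Lemma shear_funE i P : shear_fun i P = poly_map (fun k =>
  'X_k + (if k == i then (map_poly (@mpolyC 2 K) P).['X_(other i)] else 0)).
Proof. by rewrite -shear_comp_poly_map -poly_map_id. Qed.

Lemma shear_fun_comp i P Q : shear_fun i P \o shear_fun i Q = shear_fun i (P + Q).
Proof.
apply/funext => z /=; rewrite /shear_fun !mxE other_neq mulr0 addr0.
by rewrite -addrA -scalerDl addrC hornerD [Q.[_] + _]addrC addrC.
Qed.

Lemma shear_fun0 i : shear_fun i 0 = id.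
Proof. by apply/funext => z; rewrite /shear_fun horner0 scale0r addr0. Qed.

Lemma shear_aut i P : is_poly_aut (shear_fun i P).
Proof.
split; first by eexists; exact: shear_funE.
exists (shear_fun i (- P)); split.
- by eexists; exact: shear_funE.
- by move=> z; rewrite -[LHS]/((_ \o _) z) shear_fun_comp addNr shear_fun0.
- by move=> z; rewrite -[LHS]/((_ \o _) z) shear_fun_comp addrN shear_fun0.
Qed.

Lemma shear_jacobian1 i P : has_jacobian1 (shear_fun i P).
Proof.
eexists; split; first exact: shear_funE.
rewrite (jacobian_det_fix (i := i)) ?other_neq ?addr0 // eqxx mderivD.
have := mderiv_map_poly (other i) P; rewrite otherK => ->.
by rewrite addr0 mderivX mnm1E eqxx scale1r subm_self mpolyX0.
Qed.

Definition shear i P : SAut2 K :=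
  MkSAut2 (shear_aut i P) (shear_jacobian1 i P).

Lemma shear0 i : shear i 0 = 1%g.
Proof. by apply: SAut2_eq; exact: shear_fun0. Qed.

Lemma shearD i P Q : shear i (P + Q) = (shear i P * shear i Q)%g.
Proof. by apply: SAut2_eq; rewrite /= shear_fun_comp. Qed.

(** Translations are constant shears of the other coordinate; they supply the
    operator [T] of [shifted_representation_trivial]. *)
Lemma shear_translate i P :
  (shear (other i) (- 1)%:P * shear i P)%g =
  (shear i (P \Po ('X + 1)) * shear (other i) (- 1)%:P)%g.
Proof.
apply: SAut2_eq; apply/funext => z /=; rewrite /shear_fun otherK !hornerC.
rewrite horner_comp !hornerE !mxE !eqxx /= mulr1 [in RHS]addrAC.
by rewrite subrK.
Qed.

End Shears.

(** * The degree estimate *)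

Section Leading.
Context (K : numFieldType).
Implicit Types (F : 'I_2 -> {mpoly K[2]}) (p q : {mpoly K[2]}) (i j : 'I_2).
Implicit Types (m : 'X_{1..2}).

Local Notation U2 := (U_(ord0) + U_(ord_max))%MM.

Lemma mlead_mderiv_cross i p q m :
  m \in msupp (p^`M(i) * q^`M(other i)) ->
  ((m + U2)%MM <= (mlead p + mlead q)%MM)%O.
Proof.
move=> /msuppM_le/allpairsP[[a b] /= [ha hb ->]].
have supp r k c : c \in msupp r^`M(k) -> ((c + U_(k))%MM <= mlead r)%O.
  rewrite mcoeff_msupp mcoeff_deriv => h; apply: msupp_le_mlead.
  by rewrite mcoeff_msupp; apply: contra_neq h => ->; rewrite mul0rn.
have oth0 : other ord0 = ord_max by apply: val_inj.
have -> : ((a + b) + U2)%MM = ((a + U_(i)) + (b + U_(other i)))%MM.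
  apply/mnmP => k; rewrite !mnmE; have [->|->] := ord2P ord0 i; rewrite ?otherK.
    by rewrite oth0; lia.
  by rewrite oth0; lia.
by apply: lem_add; apply: supp.
Qed.

(** The Jacobian of two monomials [x^a], [x^b] is a multiple of [x^(a + b - (1, 1))]. *)
Lemma mlead_jacobian i F m : m \in msupp (jacobian_det F) ->
  ((m + U2)%MM <= (mlead (F i) + mlead (F (other i)))%MM)%O.
Proof.
rewrite (jacobian_detE i) => /msuppB_le; rewrite mem_cat => /orP[].
  exact: mlead_mderiv_cross.
by have := @mlead_mderiv_cross (other i) (F i) (F (other i)) m; rewrite otherK.
Qed.

Section DegreeEstimate.
Context (F : 'I_2 -> {mpoly K[2]}) (i : 'I_2).
Hypothesis jacF : jacobian_det F = 1.

Let j := other i.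
Let alpha := mlead (F i).
Let beta := mlead (F j).

Definition subst_mp p : {mpoly K[2]} := p \mPo [tuple F k | k < 2].

(** The leading monomial of [F i ^+ m i * F j ^+ m j], for nonzero [F k]. *)
Definition weight m : 'X_{1..2} := (alpha *+ m i + beta *+ m j)%MM.

(** Unlike the derivative, this operator preserves monomials, hence weights; it
    kills those of exponent [c] in the variable [j] and no others. *)
Definition euler_op (c : nat) p := 'X_j * p^`M(j) - c%:R *: p.

Lemma mcoeff_euler_op c p m :
  (euler_op c p)@_m = ((m j)%:R - c%:R) * p@_m.
Proof.
elim/mpolyind: p m => [|a m' p _ _ IHp] m.
  by rewrite /euler_op mderiv0 mulr0 scaler0 subr0 mcoeff0 mulr0.
have -> : euler_op c (a *: 'X_[m'] + p) =
    euler_op c (a *: 'X_[m']) + euler_op c p.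
  by rewrite /euler_op mderivD mulrDr scalerDr opprD addrACA.
rewrite [LHS]mcoeffD [in RHS]mcoeffD IHp mulrDr; congr (_ + _).
rewrite /euler_op mderivZ mderivX -!scalerAr.
have -> : (m' j)%:R *: ('X_j * 'X_[(m' - U_(j))]) = (m' j)%:R *: 'X_[K, m'].
  have [->|mj] := eqVneq (m' j) 0%N; first by rewrite !scale0r.
  rewrite -mpolyXD addmC submK //; apply/mnm_lepP => k; rewrite !mnmE.
  by case: eqP => // <-; rewrite lt0n.
rewrite mcoeffB !mcoeffZ !mcoeffX; case: eqP => [->|_]; last first.
  by rewrite !mulr0 subr0.
by rewrite !mulr1 mulrBl mulrC.
Qed.

Lemma mlead_jacobian1 : ((U2 <= (alpha + beta)%MM)%O).
Proof.
have := @mlead_jacobian i F 0%MM; rewrite jacF add0m; apply.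
by rewrite mcoeff_msupp mcoeff1 eqxx oner_eq0.
Qed.

(** By the chain rule, as [F] has Jacobian [1]: differentiating an expression in
    the [F k] formally with respect to [F j] is taking its Jacobian with [F i]. *)
Lemma subst_mderiv p : subst_mp p^`M(j) =
  jacobian_det (fun k => if k == j then subst_mp p else F k).
Proof.
pose G k := if k == j then p else 'X_k.
have := jacobian_det_comp G F; rewrite jacF mulr1.
have -> : jacobian_det G = p^`M(j).
  by rewrite (jacobian_det_fix (i := j)) /G ?other_neq ?eqxx.
rewrite -/(subst_mp _) => <-.
congr jacobian_det; apply/funext => k; rewrite /G; case: eqP => // _.
by rewrite comp_mpolyXU -tnth_nth tnth_mktuple.
Qed.

Lemma mlead_euler_op c p :
  ((mlead (subst_mp (euler_op c p)) + U2)%MM <=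
   (alpha + beta + mlead (subst_mp p))%MM)%O.
Proof.
have [->|nz] := eqVneq (subst_mp (euler_op c p)) 0.
  by rewrite mlead0 add0m (le_trans mlead_jacobian1) // lemc_addr.
have : mlead (subst_mp (euler_op c p)) \in msupp (subst_mp (euler_op c p)).
  exact: mlead_supp.
move: (mlead _) => m; rewrite /subst_mp comp_mpolyB comp_mpolyZ.
rewrite rmorphM /= comp_mpolyXU -tnth_nth tnth_mktuple -!/(subst_mp _).
move=> /msuppB_le; rewrite mem_cat => /orP[|/msuppZ_le/msupp_le_mlead le_m].
  move=> /msuppM_le/allpairsP[[a b] /= [/msupp_le_mlead ha hb ->]].
  move: hb; rewrite subst_mderiv => /(mlead_jacobian i).
  rewrite /= [i == j]eq_sym other_neq eqxx => hb.
  rewrite -addmA (le_trans (lem_add ha hb)) // le_eqVlt; apply/orP; left.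
  by apply/eqP/mnmP => k; rewrite /alpha /beta /j !mnmE; lia.
by rewrite addmC lem_add ?mlead_jacobian1.
Qed.

Hypothesis alpha_gt0 : alpha != 0%MM.
Hypothesis alpha_beta : (alpha < beta)%O.
Hypothesis not_mul : forall k, beta != (alpha *+ k)%MM.

Lemma mlead_comp_neq0 k : F k != 0.
Proof.
apply: contraTneq isT => Fk0.
have Fk : mlead (F k) = 0%MM by rewrite Fk0 mlead0.
have [ek|ek] := ord2P i k; first by move: alpha_gt0; rewrite /alpha -ek Fk eqxx.
by move: alpha_beta; rewrite /beta /j -ek Fk ltNge le0x.
Qed.

(** Two monomials of equal weight with consecutive exponents of [F j] would make
    [beta] a multiple of [alpha]. *)
Lemma weight_gap m m' : weight m = weight m' -> m != m' ->
  (m j + 2 <= m' j)%N || (m' j + 2 <= m j)%N.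
Proof.
have adj a b : weight a = weight b -> b j != (a j).+1.
  move=> /mnmP w; apply/eqP => ej; have := not_mul (a i - b i)%N.
  apply/negP; rewrite negbK; apply/eqP/mnmP => k; move: (w k).
  rewrite /weight !mnmDE !mulmnE ej; nia.
move=> w; apply: contra_neqT => gap.
have := adj _ _ w; have := adj _ _ (esym w) => n1 n2.
have ej : m j = m' j by lia.
have : exists k, alpha k != 0%N.
  apply: contrapT => na; move: alpha_gt0; case/eqP; apply/mnmP => k.
  by rewrite mnm0E; apply/eqP/negPn/negP => nk; apply: na; exists k.
move=> [k ak]; have ei : m i = m' i.
  have := congr1 (fun a : 'X_{1..2} => a k) w.
  by rewrite /weight !mnmDE !mulmnE ej; nia.
by apply/mnmP => l; have [->|->] := ord2P i l.
Qed.

Lemma mcoeff_subst_top p mu : {in msupp p, forall m, (weight m <= mu)%O} ->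
  (subst_mp p)@_mu = \sum_(m <- msupp p | weight m == mu)
    p@_m * ((F i)@_alpha ^+ m i * (F j)@_beta ^+ m j).
Proof.
move=> le_mu; rewrite /subst_mp comp_mpolyEX raddf_sum /= [RHS]big_mkcond.
rewrite !big_seq; apply: eq_bigr => m hm; rewrite mcoeffZ comp_mpolyX.
rewrite (big_ord2 _ i) /= !tnth_mktuple -/j.
have Xne0 k d : F k ^+ d != 0 by rewrite expf_neq0 ?mlead_comp_neq0.
case: eqP => [<-|/eqP ne].
  rewrite /weight -!mleadX ?mlead_comp_neq0 // mleadcM !mleadX ?mlead_comp_neq0 //.
  by rewrite !mleadcX.
have lt_mu : (mlead (F i ^+ m i * F j ^+ m j) < mu)%O.
  by rewrite mleadM // !mleadX ?mlead_comp_neq0 // lt_neqAle ne le_mu.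
by rewrite (mcoeff_gt_mlead lt_mu) mulr0.
Qed.

(** Terms of maximal weight [mu] may cancel when the [F k] are substituted. Applying
    [euler_op J], where [J] is the largest exponent of [F j] among these terms,
    removes one of them and lowers that exponent by at least two, by
    [weight_gap], while the leading monomial after substitution rises by at most
    [alpha + beta - (1, 1)], by [mlead_euler_op]. After [s <= J / 2] such steps a
    single term is left and nothing cancels. *)
Lemma mlead_subst_estimate J p mu m0 :
  {in msupp p, forall m, (weight m <= mu)%O} ->
  {in msupp p, forall m, weight m = mu -> (m j <= J)%N} ->
  m0 \in msupp p -> weight m0 = mu ->
  exists2 s, (2 * s <= J)%N &
    ((mu + U2 *+ s)%MM <= ((alpha + beta) *+ s + mlead (subst_mp p))%MM)%O.
Proof.
elim/ltn_ind: J p m0 => J IHJ p m0 le_mu le_J m0p w0.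
have [/hasP[m1 m1p /andP[/eqP w1 /eqP J1]]|/hasPn noJ] := boolP
    (has (fun m => (weight m == mu) && (m j == J)) (msupp p)); last first.
  have J_gt0 : (0 < J)%N.
    have := le_J _ m0p w0; have := noJ _ m0p; rewrite w0 eqxx /=; lia.
  have [||s s_le le_s] := IHJ J.-1 _ p m0 le_mu _ m0p w0; first by rewrite prednK.
    move=> m mp wm; have := le_J _ mp wm; have := noJ _ mp.
    by rewrite wm eqxx /=; lia.
  by exists s => //; lia.
have [/hasP[m2 m2p /andP[/eqP w2 ne2]]|/hasPn uniq1] := boolP
    (has (fun m => (weight m == mu) && (m != m1)) (msupp p)); last first.
  exists 0%N => //; rewrite !mulm0n addm0 add0m; apply: msupp_le_mlead.
  rewrite mcoeff_msupp mcoeff_subst_top // big_mkcond.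
  rewrite (bigD1_seq m1) ?msupp_uniq //= w1 eqxx.
  rewrite big_seq_cond big1 ?addr0 => [|m /andP[mp ne]]; last first.
    by have := uniq1 _ mp; rewrite ne andbT => /negPf->.
  by rewrite !mulf_neq0 -?mcoeff_msupp ?expf_neq0 ?mleadc_eq0 ?mlead_comp_neq0.
have gap m : m \in msupp p -> weight m = mu -> m != m1 -> (m j + 2 <= J)%N.
  move=> mp wm ne; have := le_J _ mp wm.
  by have := weight_gap (etrans wm (esym w1)) ne; rewrite J1; lia.
have suppE m : m \in msupp (euler_op J p) = (m \in msupp p) && (m j != J).
  by rewrite !mcoeff_msupp mcoeff_euler_op mulf_eq0 negb_or subr_eq0 eqr_nat andbC.
have J2 := gap _ m2p w2 ne2.
have [||||s s_le le_s] := IHJ (J - 2)%N _ (euler_op J p) m2 _ _ _ w2.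
- lia.
- by move=> m; rewrite suppE => /andP[/le_mu].
- move=> m; rewrite suppE => /andP[mp nJ] wm.
  have ne : m != m1 by apply: contraNneq nJ => ->; rewrite J1.
  by have := gap _ mp wm ne; lia.
- by rewrite suppE m2p /=; lia.
exists s.+1; first by lia.
rewrite !mulmSr addmA; apply: le_trans (lem_add le_s (lexx U2)) _.
rewrite -addmA -[X in (_ <= X)%O]addmA lemc_add2r.
exact: mlead_euler_op.
Qed.

End DegreeEstimate.

End Leading.

(** * Generation by shears *)

Lemma seq_argmax (d : Order.disp_t) (T : eqType) (W : orderType d) (f : T -> W)
    (s : seq T) x : x \in s ->
  exists2 y, y \in s & {in s, forall z, (f z <= f y)%O}.
Proof.
elim: s x => // a [|b s] IHs x _.
  by exists a => [|z]; rewrite ?mem_head // inE => /eqP->.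
have [y ys maxy] := IHs b (mem_head _ _).
have [le_ay|lt_ya] := leP (f a) (f y).
  exists y => [|z]; first by rewrite inE ys orbT.
  by rewrite inE => /predU1P[->|/maxy].
exists a => [|z]; first exact: mem_head.
by rewrite inE => /predU1P[->|/maxy/le_trans->] //; exact: ltW.
Qed.

Section Generation.
Context (K : numFieldType).
Implicit Types (F : 'I_2 -> {mpoly K[2]}) (i j : 'I_2) (p : {mpoly K[2]}).

Section Minimal.
Context (F : 'I_2 -> {mpoly K[2]}).
Hypothesis jacF : jacobian_det F = 1.
Hypothesis invF : forall k, exists p, subst_mp F p = 'X_k.
Hypothesis not_mul :
  forall i k, mlead (F (other i)) != (mlead (F i) *+ k)%MM.

(** Let [alpha] and [beta] be the two leading monomials, and apply the estimate to
    a [p] with [subst_mp F p = 'X_k]. The maximal weight [mu] is at least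
    [beta *+ (2 * s)], and [alpha < beta], so the estimate leaves
    [(1, 1) *+ s <= U_(k)]: there is no cancellation, some weight equals [U_(k)],
    and a weight of degree [1] is [alpha] or [beta]. *)
Lemma mlead_unit i k : (mlead (F i) < mlead (F (other i)))%O ->
  mlead (F i) = U_(k)%MM \/ mlead (F (other i)) = U_(k)%MM.
Proof.
move=> lt_ab; have [p ep] := invF k.
have a_neq0 : mlead (F i) != 0%MM.
  by have := not_mul (other i) 0; rewrite otherK mulm0n.
have b_neq0 : mlead (F (other i)) != 0%MM.
  by have := not_mul i 0; rewrite mulm0n.
have p_neq0 : p != 0.
  apply: contra_eq_neq ep => ->; rewrite /subst_mp comp_mpoly0.
  apply/eqP => /(congr1 (fun q : {mpoly K[2]} => mdeg (mlead q))).
  by rewrite mleadXm mlead0 mdeg0 mdeg1.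
have [mt mtp max_w] : exists2 y, y \in msupp p &
    {in msupp p, forall z, (weight F i z <= weight F i y)%O}.
  exact: seq_argmax (mlead_supp p_neq0).
pose tops := [seq m <- msupp p | weight F i m == weight F i mt].
have mt_top : mt \in tops by rewrite mem_filter eqxx.
have [m0] : exists2 y, y \in tops &
    {in tops, forall z : 'X_{1..2}, (z (other i) <= y (other i))%O}.
  exact: seq_argmax mt_top.
rewrite mem_filter => /andP[/eqP w0 m0p] max_j.
have le_J : {in msupp p, forall m : 'X_{1..2},
    weight F i m = weight F i mt -> (m (other i) <= m0 (other i))%N}.
  by move=> m mp wm; apply: max_j; rewrite mem_filter wm eqxx.
have [s s_le le_s] :=
  mlead_subst_estimate jacF a_neq0 lt_ab (not_mul i) max_w le_J m0p w0.
move: le_s; rewrite ep mleadXm => le_s.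
have s0 : s = 0%N.
  have le_mul r : ((mlead (F i) *+ r)%MM <= (mlead (F (other i)) *+ r)%MM)%O.
    by elim: r => [|r IHr]; rewrite ?mulm0n // !mulmS lem_add // ltW.
  have le_w : ((mlead (F (other i)) *+ s + mlead (F (other i)) *+ s)%MM <=
      weight F i mt)%O.
    rewrite -w0 /weight lem_leo //; apply/mnm_lepP => l.
    by rewrite !mnmDE !mulmnE; nia.
  have : (((U_(ord0) + U_(ord_max)) *+ s)%MM <= (U_(k)%MM : 'X_{1..2}))%O.
    rewrite -(lemc_add2r (mlead (F (other i)) *+ s + mlead (F (other i)) *+ s)%MM).
    apply: le_trans (lem_add le_w (lexx _)) (le_trans le_s _).
    rewrite lemc_add2l; have -> : ((mlead (F i) + mlead (F (other i))) *+ s =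
      mlead (F i) *+ s + mlead (F (other i)) *+ s)%MM.
      by apply/mnmP => l; rewrite !(mnmDE, mulmnE) mulnDl.
    by rewrite lemc_add2l.
  by move/lemc_mdeg; rewrite mdegMn mdegD !mdeg1; lia.
move: le_s; rewrite s0 !mulm0n addm0 add0m => le_mu.
have [/hasP[m mp /eqP wm]|/hasPn no] :=
    boolP (has (fun m => weight F i m == U_(k)%MM) (msupp p)); last first.
  have le_U : {in msupp p, forall m, (weight F i m <= U_(k)%MM)%O}.
    by move=> m mp; exact: le_trans (max_w m mp) le_mu.
  have := mcoeff_subst_top a_neq0 lt_ab le_U.
  rewrite ep mcoeffX eqxx big_seq_cond big1 => [/eqP|m /andP[mp wm]].
    by rewrite oner_eq0.
  by have := no _ mp; rewrite wm.
have dw : (mdeg (mlead (F i)) * m i + mdeg (mlead (F (other i))) * m (other i) = 1)%N.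
  by rewrite -!mdegMn -mdegD -[RHS](mdeg1 k) -wm.
move: a_neq0 b_neq0; rewrite -!mdeg_eq0 => da db.
have [mi|mi] := eqVneq (m i) 0%N.
  right; rewrite -wm /weight mi mulm0n add0m.
  have -> : m (other i) = 1%N by nia.
  by rewrite mulm1n.
left; rewrite -wm /weight; have -> : m (other i) = 0%N by nia.
have -> : m i = 1%N by nia.
by rewrite mulm1n mulm0n addm0.
Qed.

Lemma mlead_deg1 k : (mdeg (mlead (F k)) <= 1)%N.
Proof.
have [i lt_ab] : exists i, (mlead (F i) < mlead (F (other i)))%O.
  have := not_mul ord0 1; rewrite mulm1n.
  case: (ltgtP (mlead (F ord0)) (mlead (F (other ord0)))) => // h _.
    by exists ord0.
  by exists (other ord0); rewrite otherK.
have U_neq : U_(i)%MM <> U_(other i)%MM :> 'X_{1..2}.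
  by move=> /mnmP/(_ i); rewrite !mnm1E eqxx other_neq.
have [ai|bi] := mlead_unit i lt_ab; have [ao|bo] := mlead_unit (other i) lt_ab.
- by rewrite ai in ao.
- by have [->|->] := ord2P i k; rewrite ?ai ?bo mdeg1.
- by have [->|->] := ord2P i k; rewrite ?bi ?ao mdeg1.
- by rewrite bi in bo.
Qed.

End Minimal.

Lemma affine_mpolyE p : (mdeg (mlead p) <= 1)%N ->
  p = p@_U_(ord0) *: 'X_ord0 + p@_U_(ord_max) *: 'X_ord_max + p@_0%MM *: 1.
Proof.
move=> dp; apply/mpolyP => m; rewrite !mcoeffD !mcoeffZ !mcoeffX mcoeff1.
have [m2|m2] := ltnP 1 (mdeg m).
  have -> : p@_m = 0.
    apply/eqP; rewrite mcoeff_eq0; apply: contraL m2 => /msupp_le_mlead/lemc_mdeg.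
    by rewrite -leqNgt => /leq_trans->.
  do 2 (case: eqP => [e|_]; first by move: m2; rewrite -e mdeg1).
  case: eqP => [e|_]; first by move: m2; rewrite e mdeg0.
  by rewrite !mulr0 !addr0.
move: m2; rewrite leq_eqVlt ltnS leqn0 mdeg_eq0 => /orP[/mdeg1P[k /eqP->]|/eqP->].
  have Ueq a b : (U_(a)%MM == U_(b)%MM :> 'X_{1..2}) = (a == b).
    apply/eqP/eqP => [/mnmP/(_ a)|-> //]; rewrite !mnm1E eqxx.
    by case: eqP => // ->.
  have U0 : (U_(k)%MM == 0%MM :> 'X_{1..2}) = false by rewrite -mdeg_eq0 mdeg1.
  rewrite U0 mulr0 addr0 !Ueq.
  have [->|->] := ord2P ord0 k; first by rewrite eqxx mulr1 mulr0 addr0.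
  have -> : other ord0 = ord_max by apply: val_inj.
  by rewrite eqxx mulr1 mulr0 add0r.
by rewrite eqxx mulr1 -!mdeg_eq0 !mdeg1 /= !mulr0 !add0r.
Qed.

Context (Q : SAut2 K -> Prop).
Hypothesis Q1 : Q 1%g.
Hypothesis Qshear : forall i P g, Q g -> Q (shear i P * g)%g.

Lemma shear_indV i P g : Q (shear i P * g)%g -> Q g.
Proof.
by move=> /(Qshear i (- P)); rewrite mulgA -shearD addNr shear0 mul1g.
Qed.

(** If [c != 0] the linear part is a product of three elementary matrices, of
    parameters [(a - 1) / c], [c] and [(d - 1) / c]; if [c = 0], then [a != 0], and
    adding the first coordinate to the second one reduces to that case. *)
Lemma affine_shear_ind (g : SAut2 K) a b c d e f :
  (forall z, g z 0 ord0 = a * z 0 ord0 + b * z 0 ord_max + e) ->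
  (forall z, g z 0 ord_max = c * z 0 ord0 + d * z 0 ord_max + f) ->
  a * d - b * c = 1 -> Q g.
Proof.
wlog c0 : g a b c d e f / c != 0 => [gen|] g0 g1 det1.
  have [c0|] := eqVneq c 0; last by move=> c0; apply: gen c0 g0 g1 det1.
  apply: (@shear_indV ord_max 'X); apply: (gen _ a b (c + a) (d + b) e (f + e)).
  - rewrite c0 add0r; apply: contra_eq_neq det1 => ->.
    by rewrite c0 mul0r mulr0 subr0 eq_sym oner_neq0.
  - by move=> z; rewrite /= /shear_fun !mxE /= mulr0 addr0 g0.
  - move=> z; rewrite /= /shear_fun !mxE /= mulr1 hornerX g1.
    have -> : other ord_max = ord0 by apply: val_inj.
    by rewrite g0; ring.
  - by rewrite -det1; ring.
have -> : g = (shear ord0 e%:P * (shear ord_max f%:P *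
    (shear ord0 (((a - 1) / c) *: 'X) * (shear ord_max (c *: 'X) *
    (shear ord0 (((d - 1) / c) *: 'X) * 1)))))%g.
  have o0 : other ord0 = ord_max by apply: val_inj.
  have o1 : other ord_max = ord0 by apply: val_inj.
  apply: SAut2_eq; apply/funext => z; apply/rowP => k.
  have eb : b = (a * d - 1) / c by rewrite -det1; field.
  have [->|->] := ord2P ord0 k; rewrite ?o0 ?g0 ?g1 /= /shear_fun ?o0 ?o1 !hornerE;
    rewrite !mxE /= ?eb; by field.
by do 5!apply: Qshear.
Qed.

Lemma SAut2_subst_inv (g : SAut2 K) F : SAut2_fun g = poly_map F ->
  forall k, exists p, subst_mp F p = 'X_k.
Proof.
move=> eF k; have [_ [h [[G eG] gK _]]] := SAut2_aut g; exists (G k).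
have hg : poly_map G \o poly_map F = id.
  by rewrite -eF -eG; apply/funext => z; exact: gK.
by move: hg; rewrite poly_map_comp poly_map_id => /poly_map_inj/(congr1 (@^~ k)).
Qed.

Lemma SAut2_jacobian (g : SAut2 K) F :
  SAut2_fun g = poly_map F -> jacobian_det F = 1.
Proof.
by move=> eF; have [G [eG]] := SAut2_jac g; move: eG; rewrite eF => /poly_map_inj<-.
Qed.

Lemma jacobian1_neq0 i F : jacobian_det F = 1 -> F i != 0.
Proof.
move=> jF; apply: contra_eq_neq jF => Fi0.
by rewrite (jacobian_detE i) Fi0 !mderiv0 !mul0r subr0 eq_sym oner_eq0.
Qed.

(** Well-founded induction on the sum of the two leading monomials, which drops
    when a shear cancels one of them; if none does, both have degree at most
    [1], by [mlead_deg1], and the map is affine. *)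
Lemma SAut2_shear_ind g : Q g.
Proof.
suff gen (delta : 'X_{1..2}) : forall (g : SAut2 K) F, SAut2_fun g = poly_map F ->
    (mlead (F ord0) + mlead (F (other ord0)))%MM = delta -> Q g.
  by have [[F eF] _] := SAut2_aut g; apply: gen eF erefl.
elim/(@ltmwf 2): delta => delta IH {}g F eF eD.
have jF := SAut2_jacobian eF.
have [[i [k ek]]|nex] := pselect (exists i k,
    mlead (F (other i)) = (mlead (F i) *+ k)%MM).
  pose c := (F (other i))@_(mlead (F (other i))) / (F i)@_(mlead (F i)) ^+ k.
  apply: (@shear_indV (other i) (- (c *: 'X^k))).
  set g' := (_ * g)%g.
  have eg' : SAut2_fun g' = poly_map (fun l => F l +
      (if l == other i then - (c *: F i ^+ k) else 0)).
    rewrite /= eF shear_comp_poly_map otherK; congr poly_map; apply/funext => l.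
    rewrite rmorphN /= map_polyZ map_polyXn hornerN hornerZ hornerXn.
    by rewrite mul_mpolyC.
  have jF' := SAut2_jacobian eg'.
  have := jacobian1_neq0 (other i) jF'; rewrite eqxx => nz.
  have lt_o : (mlead (F (other i) - c *: F i ^+ k) < mlead (F (other i)))%O.
    have e : mlead (c *: F i ^+ k) = mlead (F (other i)).
      rewrite mleadZ ?mleadX ?(jacobian1_neq0 _ jF) ?ek //.
      by rewrite mulf_neq0 ?invr_neq0 ?expf_neq0 ?mleadc_eq0 ?jacobian1_neq0.
    rewrite lt_neqAle; apply/andP; split; last first.
      by rewrite (le_trans (mleadB_le _ _)) // e joinxx.
    apply: contra_neq nz => e_lead; apply/eqP; rewrite -mleadc_eq0 e_lead.
    rewrite mcoeffB mcoeffZ {2}ek mleadcX /c mulfVK ?subrr //.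
    by rewrite expf_neq0 ?mleadc_eq0 ?jacobian1_neq0.
  apply: IH eg' erefl; rewrite -eD.
  have [e0|e0] := ord2P i ord0; rewrite e0 ?otherK ?eqxx;
    rewrite ?[i == _]eq_sym ?other_neq addr0.
    by rewrite ltmc_add2r.
  by rewrite ltmc_add2l.
have deg1 := mlead_deg1 jF (SAut2_subst_inv eF) _.
have {}deg1 k : (mdeg (mlead (F k)) <= 1)%N.
  by apply: deg1 => i l; apply/eqP => e; apply: nex; exists i, l.
pose co k m := (F k)@_m.
have eg z k : g z 0 k =
    co k U_(ord0)%MM * z 0 ord0 + co k U_(ord_max)%MM * z 0 ord_max + co k 0%MM.
  rewrite eF mxE (affine_mpolyE (deg1 k)).
  by rewrite !mevalD !mevalZ !mevalXU meval1 mulr1.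
apply: (affine_shear_ind (eg ^~ ord0) (eg ^~ ord_max)).
have o0 : other ord0 = ord_max by apply: val_inj.
have dF k l : (F k)^`M(l) = (co k U_(l)%MM)%:MP.
  apply/mpolyP => m; rewrite mcoeff_deriv mcoeffC.
  have [->|m0] := eqVneq m 0%MM; first by rewrite add0m mnm0E mulr1.
  rewrite mulr0 mcoeff_gt_mlead ?mul0rn // lt_mdeg_ltmc //.
  rewrite (leq_ltn_trans (deg1 k)) // mdegD mdeg1 addn1 ltnS.
  by rewrite lt0n mdeg_eq0.
move: jF; rewrite (jacobian_detE ord0) !dF o0 -!mpolyCM -mpolyCB -mpolyC1.
by move/(congr1 (mcoeff 0%MM)); rewrite !mcoeffC eqxx !mulr1.
Qed.

End Generation.

(** * Triviality of representations *)

Lemma multiplicative1 (G H : groupType) (f : {multiplicative G -> H}) :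
  f 1%g = 1%g.
Proof. by apply: (mulgI (f 1%g)); rewrite -gmulfM !mulg1. Qed.

Lemma rep_shear_eq1 (K : numClosedFieldType) (n : nat)
    (rho : {multiplicative SAut2 K -> GL K n}) i P :
  rho (shear i P) = 1%g.
Proof.
apply: val_inj => /=.
case: n rho => [|n] rho; first by rewrite [LHS]flatmx0 [RHS]flatmx0.
have rhoM g h : GL_mx (rho (g * h)%g) = GL_mx (rho g) *m GL_mx (rho h).
  by rewrite gmulfM.
pose T := GL_mx (rho (shear (other i) (- 1)%:P)).
apply: (@shifted_representation_trivial K n
          (fun P' => GL_mx (rho (shear i P'))) T _ _ _ _ P) => [|P1 P2||P1].
- by rewrite shear0 multiplicative1.
- by rewrite shearD rhoM.
- exact: GL_mxP.
- by rewrite -!rhoM shear_translate.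
Qed.

Theorem theorem1 (R : realType) (n : nat) (n_gt0 : (0 < n)%N)
    (rho : {multiplicative SAut2 R[i] -> GL R[i] n}) (g : SAut2 R[i]) :
  rho g = 1%g.
Proof.
elim/(@SAut2_shear_ind R[i]): g => [|i P g IHg]; first exact: multiplicative1.
by rewrite gmulfM rep_shear_eq1 mul1g.
Qed.
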